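(* Let $n\in\mathbb{N}$, $n\ge1$, and $m=m^{(n)}=(m_1,\dots,m_n)\in\mathbb{R}^n$. Realizability, I-realizability and B-realizability all refer to $\mathbb{N}_0$. Then: (a) If $n=1$ then $m=(m_1)$ is I-realizable if $m_1>0$, B-realizable if $m_1=0$, and not realizable if $m_1<0$. (b) If $n\ge2$ and $m^{(n-1)}$ is not realizable then $m^{(n)}$ is not realizable. (c) If $n\ge2$ and $m^{(n-1)}$ is I-realizable then a minimizing polynomial for $m^{(n)}$ exists, i.e. there is $P_n^{(m)}\in\mathcal{P}_n$ with $L_{P_n^{(m)}}(m)\le L_P(m)$ for all $P\in\mathcal{P}_n$; and $m^{(n)}$ is realizable if and only if $$L_{P_n^{(m)}}(m)\ge 0.$$ In this case, $m^{(n)}$ is I-realizable if this inequality is strict and B-realizable if equality holds. (d) If $n\ge2$ and $m^{(n-1)}$ is B-realizable, so that $L_P(m)=0$ for some $P\in\mathcal{P}_{n-i}$ with $i\in\{1,2\}$, then $m^{(n)}$ is realizable, and in particular B-realizable, if and only if $L_{x^iP}(m)=0$.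
   Context: $\mathbb{N}_0=\{0,1,2,\dots\}$. A moment vector $m=(m_1,\dots,m_n)$ is an $n$-tuple of real numbers; by convention $m_0=1$, and $m^{(j)}=(m_1,\dots,m_j)$ for $j\le n$. It is realizable (on $\mathbb{N}_0$) if there is a probability measure $\mu$ on $\mathbb{N}_0$ with $\int x^k\,d\mu(x)=m_k$ for $k=1,\dots,n$. For a polynomial $P(x)=\sum_{k=0}^n p_kx^k$ of degree at most $n$, $L_P(m)=\sum_{k=0}^n p_km_k$. For $k\ge 0$, $\mathcal{P}_k$ denotes the set of monic polynomials of degree $k$ which have $k$ distinct roots in $\mathbb{N}_0$ and are nonnegative on $\mathbb{N}_0$ (so $\mathcal{P}_0=\{1\}$). A realizable moment vector $m^{(n)}$ is I-realizable if $L_P(m)>0$ for all $P\in\mathcal{P}_n\cup\mathcal{P}_{n-1}$; otherwise, i.e. if it is realizable and $L_P(m)=0$ for some $P\in\mathcal{P}_n\cup\mathcal{P}_{n-1}$, it is B-realizable. *)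

(* Defs.v *)
From HB Require Import structures.
From mathcomp Require Import all_boot all_order all_algebra.
From mathcomp Require Import all_classical all_reals all_analysis.

Set Implicit Arguments.
Unset Strict Implicit.
Unset Printing Implicit Defensive.

Import Order.TTheory GRing.Theory Num.Theory.
Import numFieldNormedType.Exports.

Local Open Scope ring_scope.

(* A moment vector (m_1, ..., m_n) is a sequence of length n; m^(j) is then
   [take j m]. *)

(* m_k, with the convention m_0 = 1; indices k > n give the junk value 0. *)
Definition moment (R : realType) (m : seq R) (k : nat) : R := (1 :: m)`_k.

(* [nat] carries the discrete sigma-algebra. *)
Definition realizable (R : realType) (m : seq R) : Prop :=
  exists mu : probability nat R,
    forall k : nat, (1 <= k <= size m)%N ->
      (\int[mu]_x ((x%:R : R) ^+ k)%:E)%E = (moment m k)%:E.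

(* Only meaningful when the degree of P is at most [size m]: higher
   coefficients are ignored. *)
Definition L (R : realType) (P : {poly R}) (m : seq R) : R :=
  \sum_(k < (size m).+1) P`_k * moment m k.

Definition calP (R : realType) (k : nat) (P : {poly R}) : Prop :=
  [/\ P \is monic,
      size P = k.+1,
      exists s : seq nat,
        [/\ uniq s, size s = k & forall a : nat, a \in s -> root P a%:R] &
      forall x : nat, 0 <= P.[x%:R]].

(* In the next two definitions the moment vector is assumed to be nonempty. *)
Definition I_realizable (R : realType) (m : seq R) : Prop :=
  realizable m /\
  forall P : {poly R},
    calP (size m) P \/ calP (size m).-1 P -> 0 < L P m.

Definition B_realizable (R : realType) (m : seq R) : Prop :=
  realizable m /\
  exists P : {poly R},
    (calP (size m) P \/ calP (size m).-1 P) /\ L P m = 0.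

Definition minimizing (R : realType) (m : seq R) (P : {poly R}) : Prop :=
  calP (size m) P /\
  forall Q : {poly R}, calP (size m) Q -> L P m <= L Q m.

(* Main.v *)
(** Idea.  Let [ell] be the linear functional sending x^k to m_k.  The polynomials
    of P_k are products over root sets consisting of pairs {a, a+1}, plus the
    root 0 when k is odd.  Factoring out the largest pair shows inductively that
    if [ell] is positive on P_j for j <= k, then ell(P) >= delta W(P) on P_k with
    W(P) = prod (1 + c) over the roots c of P.  On P_(k+2), this bound still holds
    for all but finitely many P, so a minimizer exists.

    The n roots of a minimizer P of ell on P_n carry a measure with moments
    m_0, ..., m_(n-1), with weights given by Lagrange interpolation: a negative
    weight at a root c would allow moving c to another integer and decreasing
    ell.  The n-th moment of this measure is m_n - ell(P).  Adding a small mass at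
    a far away point gives another measure with the same lower moments and with
    an arbitrarily large n-th moment; a convex combination of both has the
    n-th moment m_n as soon as ell(P) >= 0.  In the boundary case every
    realizing measure is carried by the roots of the annihilated polynomial. *)

Require Import Defs.
From HB Require Import structures.
From mathcomp Require Import all_boot all_order all_algebra.
From mathcomp Require Import all_classical all_reals all_analysis.
From mathcomp Require Import ring lra zify.

Set Implicit Arguments.
Unset Strict Implicit.
Unset Printing Implicit Defensive.

Import Order.TTheory GRing.Theory Num.Theory.
Import numFieldNormedType.Exports.

Local Open Scope ring_scope.

(** * Root lists, their polynomials, and the linear functional of a moment sequence *)

Definition root_poly (R : realType) (s : seq nat) : {poly R} :=
  \prod_(c <- s) ('X - c%:R%:P).

(** The yardstick for values of [moment_functional]. The shift by one keeps it at least 1 even when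
    0 is a root. *)
Definition root_weight (R : realType) (s : seq nat) : R :=
  \prod_(c <- s) (1 + c%:R).

Definition nonneg_roots (R : realType) (s : seq nat) : Prop :=
  uniq s /\ forall x : nat, 0 <= (root_poly R s).[x%:R].

(** Summing up to [size P] against a total sequence [f] makes this linear on polynomials of all
    degrees. *)
Definition moment_functional (R : realType) (f : nat -> R) (P : {poly R}) : R :=
  \sum_(k < size P) P`_k * f k.

Lemma root_poly_cons (R : realType) c s :
  root_poly R (c :: s) = ('X - c%:R%:P) * root_poly R s.
Proof. exact: big_cons. Qed.

Lemma size_root_poly (R : realType) s : size (root_poly R s) = (size s).+1.
Proof. exact: size_prod_XsubC. Qed.

Lemma monic_root_poly (R : realType) s : root_poly R s \is monic.
Proof. exact: monic_prod_XsubC. Qed.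

Lemma perm_root_poly (R : realType) s t :
  perm_eq s t -> root_poly R s = root_poly R t.
Proof. exact: perm_big. Qed.

Lemma horner_root_poly_cons (R : realType) c s (x : R) :
  (root_poly R (c :: s)).[x] = (x - c%:R) * (root_poly R s).[x].
Proof. by rewrite root_poly_cons !hornerE. Qed.

Lemma root_root_poly (R : realType) s (c : nat) :
  root (root_poly R s) c%:R = (c \in s).
Proof.
rewrite /root_poly -(big_map (fun c : nat => c%:R : R) xpredT (fun z => 'X - z%:P)).
by rewrite root_prod_XsubC mem_map //; exact/mulrIn/oner_neq0.
Qed.

Lemma root_poly_gt0 (R : realType) s (x : nat) :
  all (fun c => (c < x)%N) s -> 0 < (root_poly R s).[x%:R].
Proof.
elim: s => [|c s ihs] /=; first by rewrite /root_poly big_nil hornerE.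
case/andP=> cx /ihs sx; rewrite horner_root_poly_cons mulr_gt0 //.
by rewrite subr_gt0 ltr_nat.
Qed.

Lemma root_weight_cons (R : realType) c s :
  root_weight R (c :: s) = (1 + c%:R) * root_weight R s.
Proof. exact: big_cons. Qed.

Lemma root_weight_ge1 (R : realType) s : 1 <= root_weight R s.
Proof.
elim: s => [|c s ihs]; first by rewrite /root_weight big_nil.
have c0 : 0 <= c%:R :> R by [].
by rewrite root_weight_cons; nra.
Qed.

Lemma root_weight_gt0 (R : realType) s : 0 < root_weight R s.
Proof. exact: lt_le_trans ltr01 (root_weight_ge1 R s). Qed.

Lemma le_root_weight (R : realType) s c : c \in s -> c%:R <= root_weight R s.
Proof.
elim: s => // b s ihs; rewrite inE root_weight_cons.
have s1 := root_weight_ge1 R s.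
have b0 : 0 <= b%:R :> R by [].
by case/orP => [/eqP -> | /ihs cs]; nra.
Qed.

Lemma root_weight_le (R : realType) s A :
  all (fun c => (c < A)%N) s -> root_weight R s <= A%:R ^+ size s.
Proof.
elim: s => [|c s ihs] /=; first by rewrite /root_weight big_nil.
case/andP=> cA /ihs sA; rewrite root_weight_cons exprS.
have c0 : 0 <= 1 + c%:R :> R by rewrite addrC natr1.
have cAR : 1 + c%:R <= A%:R :> R by rewrite addrC natr1 ler_nat.
exact: ler_pM c0 (ltW (root_weight_gt0 R s)) cAR sA.
Qed.

(** Each factor satisfies |x - c| <= x + c <= (1 + x)(1 + c). *)
Lemma horner_root_poly_le (R : realType) s (x : nat) :
  `|(root_poly R s).[x%:R]| <= (1 + x%:R) ^+ size s * root_weight R s.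
Proof.
elim: s => [|c s ihs].
  by rewrite /root_weight /root_poly !big_nil hornerE normr1 mul1r.
rewrite horner_root_poly_cons root_weight_cons exprS mulrACA normrM.
apply: ler_pM => //.
have c0 : 0 <= c%:R :> R by [].
have x0 : 0 <= x%:R :> R by [].
by apply: le_trans (ler_normB _ _) _; rewrite !ger0_norm //; nra.
Qed.

Lemma moment_functional_widen (R : realType) (f : nat -> R) N (P : {poly R}) :
  (size P <= N)%N -> moment_functional f P = \sum_(k < N) P`_k * f k.
Proof.
move=> PN; rewrite /moment_functional.
rewrite (big_ord_widen N (fun k => P`_k * f k)) // big_mkcond /=.
apply: eq_bigr => i _; case: ltnP => // Pi.
by rewrite nth_default // mul0r.
Qed.

Lemma moment_functionalD (R : realType) (f : nat -> R) (P Q : {poly R}) :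
  moment_functional f (P + Q) = moment_functional f P + moment_functional f Q.
Proof.
set N := maxn (size P) (size Q).
rewrite (moment_functional_widen f (N := N)); last exact: size_polyD.
rewrite (moment_functional_widen f (N := N)); last exact: leq_maxl.
rewrite (moment_functional_widen f (N := N)); last exact: leq_maxr.
by rewrite -big_split; apply: eq_bigr => i _; rewrite coefD mulrDl.
Qed.

Lemma moment_functionalZ (R : realType) (f : nat -> R) a (P : {poly R}) :
  moment_functional f (a *: P) = a * moment_functional f P.
Proof.
rewrite (moment_functional_widen f (N := size P)) ?size_scale_leq //.
by rewrite mulr_sumr; apply: eq_bigr => i _; rewrite coefZ mulrA.
Qed.

Lemma moment_functionalB (R : realType) (f : nat -> R) (P Q : {poly R}) :
  moment_functional f (P - Q) = moment_functional f P - moment_functional f Q.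
Proof. by rewrite -scaleN1r moment_functionalD moment_functionalZ mulN1r. Qed.

Lemma moment_functionalXn (R : realType) (f : nat -> R) k :
  moment_functional f 'X^k = f k.
Proof.
rewrite /moment_functional size_polyXn big_ord_recr /= coefXn eqxx mul1r.
by rewrite big1 ?add0r // => i _; rewrite coefXn ltn_eqF ?mul0r.
Qed.

Lemma moment_functionalC (R : realType) (f : nat -> R) :
  moment_functional f 1 = f 0%N.
Proof. by rewrite -(moment_functionalXn f) expr0. Qed.

Lemma eq_moment_functional (R : realType) (f g : nat -> R) N (P : {poly R}) :
  (size P <= N)%N -> (forall k, (k < N)%N -> f k = g k) ->
  moment_functional f P = moment_functional g P.
Proof.
move=> PN fg; apply: eq_bigr => i _; rewrite fg //.
exact: leq_trans (ltn_ord i) PN.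
Qed.

Lemma moment_functional_lin (R : realType) (f g : nat -> R) a b (P : {poly R}) :
  moment_functional (fun k => a * f k + b * g k) P =
  a * moment_functional f P + b * moment_functional g P.
Proof.
by rewrite !mulr_sumr -big_split; apply: eq_bigr => i _ /=; ring.
Qed.

Lemma moment_functional_exp (R : realType) (x : R) (P : {poly R}) :
  moment_functional (fun k => x ^+ k) P = P.[x].
Proof. by rewrite horner_coef. Qed.

Lemma moment_functional_XsubC (R : realType) (f : nat -> R) i (c : R) (P : {poly R}) :
  moment_functional f ('X^i * (('X - c%:P) * P)) =
  moment_functional f ('X^(i.+1) * P) - c * moment_functional f ('X^i * P).
Proof.
rewrite -moment_functionalZ -moment_functionalB; congr moment_functional.
by rewrite mulrBl mulrBr mulrA -exprSr mulrCA mul_polyC.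
Qed.

(** The power of X is carried along because splitting off a root c produces one term with exponent i
    + 1 and c times one with exponent i; the factor 1 + c of the weight absorbs both. *)
Lemma moment_functional_le (R : realType) (f : nat -> R) s i :
  `|moment_functional f ('X^i * root_poly R s)| <=
  (\sum_(k < (i + size s).+1) `|f k|) * root_weight R s.
Proof.
elim: s i => [|c s ihs] i.
  rewrite /root_poly /root_weight !big_nil !mulr1 moment_functionalXn addn0.
  by rewrite big_ord_recr /= lerDr sumr_ge0.
rewrite root_poly_cons moment_functional_XsubC root_weight_cons.
apply: le_trans (ler_normB _ _) _; rewrite normrM.
have h1 := ihs i.+1; have h2 := ihs i.
rewrite /= addnS; rewrite addSn in h1.
have sW := root_weight_gt0 R s.
rewrite big_ord_recr /= in h1 *.
set S := \sum_(_ < _) _ in h1 h2 *.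
have c0 : 0 <= c%:R :> R by [].
have S0 : 0 <= S by exact: sumr_ge0.
have f0 : 0 <= `|f (i + size s).+1| by [].
rewrite (ger0_norm c0).
set W := root_weight R s in h1 h2 sW *.
have : c%:R * `|moment_functional f ('X^i * root_poly R s)| <= c%:R * (S * W).
  exact: ler_wpM2l.
have : 0 <= c%:R * (`|f (i + size s).+1| * W) by rewrite !mulr_ge0 // ltW.
by lra.
Qed.

(** * Polynomials that are nonnegative on the natural numbers *)

Lemma perm_nonneg_roots (R : realType) s t :
  perm_eq s t -> nonneg_roots R s -> nonneg_roots R t.
Proof.
by move=> st [us s0]; split; [rewrite -(perm_uniq st)|rewrite -(perm_root_poly _ st)].
Qed.

(** No natural number lies strictly between [a] and [a.+1]. *)
Lemma consecutive_factor_ge0 (R : realType) (a x : nat) :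
  0 <= (x%:R - a.+1%:R) * (x%:R - a%:R) :> R.
Proof.
have [ax|xa] := ltnP a x.
  by rewrite mulr_ge0 // subr_ge0 ler_nat // ltnW.
by rewrite mulr_le0 // subr_le0 ler_nat // leqW.
Qed.

Lemma nonneg_roots_pair (R : realType) a s :
  nonneg_roots R s -> all (fun c => (c < a)%N) s ->
  nonneg_roots R [:: a.+1, a & s].
Proof.
move=> [us s0] sa; split.
  rewrite /= us inE negb_or -[a.+1 == a]/(a.+1 == a :> nat) gtn_eqF //= andbT.
  apply/andP; split; apply/negP => /(allP sa); rewrite ?ltnn //.
  by rewrite ltnNge leqW.
move=> x; rewrite !horner_root_poly_cons mulrA mulr_ge0 //.
exact: consecutive_factor_ge0.
Qed.

Lemma nonneg_roots_nil (R : realType) : nonneg_roots R [::].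
Proof. by split=> // x; rewrite /root_poly big_nil hornerE. Qed.

Lemma nonneg_roots1 (R : realType) c : nonneg_roots R [:: c] <-> c = 0%N.
Proof.
split=> [[_ /(_ 0%N)]|->].
  rewrite /root_poly big_seq1 hornerE hornerX hornerN hornerC mulr0n add0r.
  by rewrite oppr_ge0 lern0 => /eqP.
by split=> // x; rewrite /root_poly big_seq1 !hornerE mulr0n subr0.
Qed.

Lemma nonneg_roots_exists (R : realType) k :
  exists2 s, nonneg_roots R s & size s = k.
Proof.
have [N] := ubnP k; elim: N k => // N IH [|[|k]] kN.
- by exists [::]; [exact: nonneg_roots_nil|].
- by exists [:: 0%N]; [exact/nonneg_roots1|].
have [s s0 sk] := IH k (ltnW kN).
exists [:: (\max_(c <- s) c).+2, (\max_(c <- s) c).+1 & s]; last by rewrite /= sk.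
apply: nonneg_roots_pair => //; apply/allP => c cs; rewrite ltnS.
exact: leq_bigmax_seq.
Qed.

(* If the largest root is b and b - 1 is not a root, then the polynomial is
   negative at b - 1. *)
Lemma nonneg_roots_top (R : realType) s :
  nonneg_roots R s -> (2 <= size s)%N ->
  exists a t, [/\ perm_eq s [:: a.+1, a & t], all (fun c => (c < a)%N) t &
                  nonneg_roots R t].
Proof.
move=> s0 s2; pose u := sort geq s.
have su : perm_eq s u by rewrite perm_sym perm_sort.
have := sort_sorted (fun x y => leq_total y x) s; rewrite -/u.
have [uu u0] := perm_nonneg_roots su s0.
move: s2; rewrite (perm_size su); case: u su uu u0 => [|b [|a t]] // su uu u0 _.
have gt : transitive geq by move=> x y z xy /leq_trans; apply.
rewrite (sorted_pairwise gt) => /and3P[/andP[ab tb] ta _].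
move: uu; rewrite /= inE negb_or => /and3P[/andP[ba bt] at_ ut].
have {}ab : (a < b)%N by rewrite ltn_neqAle eq_sym ba.
have {}ta : all (fun c => (c < a)%N) t.
  apply/allP => c ct; have ca : (c <= a)%N := allP ta _ ct.
  rewrite ltn_neqAle ca andbT.
  by apply: contraNneq at_ => <-.
have t_pos x : (a <= x)%N -> 0 < (root_poly R t).[x%:R].
  move=> ax; apply: root_poly_gt0; apply/allP => c /(allP ta) ca.
  exact: leq_trans ax.
have ba1 : b = a.+1.
  apply/eqP; rewrite eqn_leq ab andbT leqNgt; apply/negP => a1b.
  have := u0 b.-1; rewrite !horner_root_poly_cons leNgt => /negP; apply.
  rewrite pmulr_llt0; first by rewrite subr_lt0 ltr_nat; lia.
  by rewrite mulr_gt0 ?t_pos ?subr_gt0 ?ltr_nat; lia.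
subst b; exists a, t; split=> //; split=> // x.
have [ax|xa] := leqP a x; first exact/ltW/t_pos.
have := u0 x; rewrite !horner_root_poly_cons mulrA pmulr_rge0 //.
by rewrite nmulr_lgt0 subr_lt0 ltr_nat // leqW.
Qed.

(** The positivity that I-realizability provides, stated for all lower degrees so that induction can
    run on it. *)
Definition positive_upto (R : realType) (f : nat -> R) n : Prop :=
  forall s, (size s <= n)%N -> nonneg_roots R s ->
    0 < moment_functional f (root_poly R s).

Lemma positive_uptoW (R : realType) (f : nat -> R) k n :
  (k <= n)%N -> positive_upto f n -> positive_upto f k.
Proof. by move=> kn fn s sk; apply: fn; exact: leq_trans kn. Qed.

(** The last coefficient is quadratic in [a] and the middle one only linear, which drives
    [coercive_step]. *)
Lemma moment_functional_pair (R : realType) (f : nat -> R) a s :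
  moment_functional f (root_poly R [:: a.+1, a & s]) =
  moment_functional f ('X^2 * root_poly R s)
  - (a.+1%:R + a%:R) * moment_functional f ('X^1 * root_poly R s)
  + a.+1%:R * a%:R * moment_functional f (root_poly R s).
Proof.
rewrite -[root_poly R _]mul1r -(expr0 'X) !root_poly_cons.
rewrite !moment_functional_XsubC expr0 !mul1r; ring.
Qed.

(** Split off the top pair a, a + 1. For large a the quadratic term, bounded below by the hypothesis
    on the other k roots, absorbs the remaining two terms at the cost of half of [d]. *)
Lemma coercive_step (R : realType) (f : nat -> R) k (d : R) : 0 < d ->
  (forall s, nonneg_roots R s -> size s = k ->
     d * root_weight R s <= moment_functional f (root_poly R s)) ->
  exists A, forall s, nonneg_roots R s -> size s = k.+2 ->
    all (fun c => (c < A)%N) s \/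
    d / 2 * root_weight R s <= moment_functional f (root_poly R s).
Proof.
move=> d0 fd; pose M := \sum_(j < (2 + k).+1) `|f j|.
have M0 : 0 <= M by exact: sumr_ge0.
(* After division by (a + 1) W, with W the weight of the other roots, the required bound becomes a d
   >= 4 M + 2 d. *)
pose A := Num.bound (4 * M / d + 2).
have AM : 4 * M + 2 * d <= A%:R * d.
  have : 4 * M / d + 2 < A%:R.
    by apply: archi_boundP; rewrite addr_ge0 // divr_ge0 ?mulr_ge0 // ltW.
  rewrite -(ltr_pM2r d0) mulrDl mulfVK ?gt_eqF //; exact: ltW.
(* The largest root is [a.+1], so [a < A] places all roots strictly below [A.+1]. *)
exists A.+1 => s s0 sk.
have [|a [t [st ta t0]]] := nonneg_roots_top s0; first by rewrite sk.
have tk : size t = k by move: (perm_size st); rewrite sk => -[].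
rewrite (perm_all _ st) (perm_root_poly _ st) /root_weight (perm_big _ st) /=.
rewrite -/(root_weight _ _) !root_weight_cons.
have [aA|Aa] := ltnP a A.
  left; apply/and3P; split; [by []|exact: leqW|apply: sub_all ta => c ca].
  exact: ltn_trans ca (leqW aA).
right; rewrite moment_functional_pair.
have h0 := fd t t0 tk.
have h1 := moment_functional_le f t 1; have h2 := moment_functional_le f t 2.
have W0 := root_weight_gt0 R t.
have {}h2 : `|moment_functional f ('X^2 * root_poly R t)| <= M * root_weight R t.
  by rewrite /M -tk.
have {}h1 : `|moment_functional f ('X^1 * root_poly R t)| <= M * root_weight R t.
  apply: le_trans h1 _; rewrite ler_pM2r // tk /M [leRHS]big_ord_recr /=.
  by rewrite lerDl.
set W := root_weight R t in h0 h1 h2 W0 *.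
set x0 := moment_functional f (root_poly R t) in h0 *.
set x1 := moment_functional f _ in h1 *.
set x2 := moment_functional f _ in h2 *.
rewrite -[a.+1%:R]natr1.
have {}Aa : A%:R <= a%:R :> R by rewrite ler_nat.
have a0 : 0 <= a%:R :> R by [].
set z := a%:R in a0 Aa *.
have Az : 4 * M + 2 * d <= z * d.
  by apply: le_trans AM _; rewrite ler_pM2r.
have {h1} : (z + 1 + z) * x1 <= (z + 1 + z) * (M * W).
  by rewrite ler_wpM2l //; [lra|apply: le_trans h1; exact: ler_norm].
have {h2} : - (M * W) <= x2 by move: h2; rewrite ler_norml => /andP[].
have {h0} : (z + 1) * z * (d * W) <= (z + 1) * z * x0.
  by rewrite ler_wpM2l // mulr_ge0 // addr_ge0.
have : 0 <= (z + 1) * W * (z * d - 4 * M - 2 * d).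
  by apply: mulr_ge0; [apply: mulr_ge0; [lra|exact: ltW]|lra].
lra.
Qed.

(** * Minimizers *)

Definition minimal_roots (R : realType) (f : nat -> R) (s : seq nat) : Prop :=
  nonneg_roots R s /\
  forall t, nonneg_roots R t -> size t = size s ->
    moment_functional f (root_poly R s) <= moment_functional f (root_poly R t).

(** Any list doing at least as well as a fixed reference list [s0] has all its roots below some [B],
    so the minimum can be sought over the finite type [k.-tuple 'I_B]. *)
Lemma minimal_roots_of_coercive (R : realType) (f : nat -> R) k A (d : R) :
  0 < d ->
  (forall s, nonneg_roots R s -> size s = k ->
    all (fun c => (c < A)%N) s \/
    d * root_weight R s <= moment_functional f (root_poly R s)) ->
  exists2 s, minimal_roots f s & size s = k.
Proof.
move=> d0 fd; have [s0 s00 s0k] := nonneg_roots_exists R k.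
pose K := moment_functional f (root_poly R s0).
(* In the coercive alternative a root c satisfies d c <= d W <= K, with W the weight of its list,
   hence c <= |K| / d. *)
pose B := maxn A (Num.bound (`|K| / d)).
have small t : nonneg_roots R t -> size t = k ->
    moment_functional f (root_poly R t) <= K ->
    exists u : k.-tuple 'I_B, map val u = t.
  move=> t0 tk tK.
  have tB : all (fun c => (c < B)%N) t.
    have [|dt] := fd t t0 tk.
      by apply: sub_all => c cA; rewrite leq_max cA.
    apply/allP => c ct; rewrite leq_max; apply/orP; right.
    rewrite -(ltr_nat R); apply: le_lt_trans (le_root_weight R ct) _.
    apply: le_lt_trans (archi_boundP (divr_ge0 (normr_ge0 K) (ltW d0))).
    rewrite ler_pdivlMr // mulrC; apply: le_trans (le_trans dt tK) _.
    exact: ler_norm.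
  have tE : map val (pmap (insub : nat -> option 'I_B) t) = t.
    rewrite (pmap_filter (@insubK _ _ _)); apply/all_filterP.
    by apply: sub_all tB => c cB; rewrite /= isSome_insub.
  have tk' : size (pmap (insub : nat -> option 'I_B) t) == k.
    by rewrite -(size_map val) tE tk.
  by exists (Tuple tk').
have [u0 u0E] := small s0 s00 s0k (lexx _).
pose p (u : k.-tuple 'I_B) := `[< nonneg_roots R (map val u) >].
pose F (u : k.-tuple 'I_B) := moment_functional f (root_poly R (map val u)).
have pu0 : p u0 by apply/asboolP; rewrite u0E.
case: (Order.TotalTheory.arg_minP F pu0) => u /asboolP u_ok umin.
exists (map val u); last by rewrite size_map size_tuple.
split=> // t t0; rewrite size_map size_tuple => tk.
have [tK|Kt] := leP (moment_functional f (root_poly R t)) K.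
  have [v vE] := small t t0 tk tK.
  by rewrite -vE; apply: umin; apply/asboolP; rewrite vE.
by apply: le_trans (ltW Kt); rewrite /K -u0E; exact: umin.
Qed.

(** Induction in steps of two, since roots come off in pairs. [coercive_step] settles all but
    finitely many root lists; for those the minimum, which is positive, provides a constant. *)
Lemma coercive (R : realType) (f : nat -> R) k : positive_upto f k ->
  exists2 d : R, 0 < d & forall s, nonneg_roots R s -> size s = k ->
    d * root_weight R s <= moment_functional f (root_poly R s).
Proof.
have [N] := ubnP k; elim: N k => // N IH [|[|k]] kN fk.
- exists (moment_functional f (root_poly R [::])).
    by apply: fk => //; exact: nonneg_roots_nil.
  by move=> s _ /size0nil ->; rewrite /root_weight big_nil mulr1.
- exists (moment_functional f (root_poly R [:: 0%N])).
    by apply: fk => //; exact/nonneg_roots1.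
  case=> [|c []] // /nonneg_roots1 -> _.
  by rewrite /root_weight big_seq1 addr0 mulr1.
have [d d0 fd] := IH k (ltnW kN) (positive_uptoW (leqW (leqnSn k)) fk).
have [A fA] := coercive_step d0 fd.
have [s [s0 smin] sk] := minimal_roots_of_coercive (divr_gt0 d0 (ltr0Sn R 1)) fA.
have s_gt0 : 0 < moment_functional f (root_poly R s) by apply: fk => //; rewrite sk.
set v := moment_functional f _ in smin s_gt0.
have A0 : 0 < A.+1%:R ^+ k.+2 :> R by rewrite exprn_gt0.
(* The second entry serves the lists below [A], whose weight is at most (A + 1)^(k + 2); using
   [A.+1] keeps the denominator positive. *)
exists (Num.min (d / 2) (v / A.+1%:R ^+ k.+2)).
  by rewrite lt_min !divr_gt0.
move=> t t0 tk; have W0 := root_weight_gt0 R t.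
have [tA|] := fA t t0 tk; last first.
  by apply: le_trans; rewrite ler_pM2r // ge_min lexx.
apply: le_trans (smin t t0 _); last by rewrite tk.
have tW : root_weight R t <= A.+1%:R ^+ k.+2.
  by rewrite -tk; apply: root_weight_le; apply: sub_all tA => c /leqW.
apply: (@le_trans _ _ (v / A.+1%:R ^+ k.+2 * root_weight R t)).
  by rewrite ler_pM2r // ge_min lexx orbT.
by rewrite mulrAC ler_pdivrMr // ler_pM2l.
Qed.

Lemma coercive_upto (R : realType) (f : nat -> R) n : positive_upto f n ->
  exists2 d : R, 0 < d & forall s, nonneg_roots R s -> (size s <= n)%N ->
    d * root_weight R s <= moment_functional f (root_poly R s).
Proof.
elim: n => [|n IH] fn.
  have [d d0 fd] := coercive fn; exists d => // s s0.
  by rewrite leqn0 => /eqP; exact: fd.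
have [d d0 fd] := IH (positive_uptoW (leqnSn n) fn).
have [e e0 fe] := coercive fn.
exists (Num.min d e); first by rewrite lt_min d0.
move=> s s0; have W0 := root_weight_gt0 R s.
rewrite leq_eqVlt => /orP[/eqP sn|sn].
  by apply: le_trans (fe s s0 sn); rewrite ler_pM2r // ge_min lexx orbT.
by apply: le_trans (fd s s0 sn); rewrite ler_pM2r // ge_min lexx.
Qed.

(** Positivity is assumed only up to two degrees below, so the minimum itself may have any sign. *)
Lemma minimal_roots_exists (R : realType) (f : nat -> R) n :
  positive_upto f n -> exists2 s, minimal_roots f s & size s = n.+2.
Proof.
move=> fn; have [d d0 fd] := coercive fn.
have [A fA] := coercive_step d0 fd.
exact: minimal_roots_of_coercive (divr_gt0 d0 (ltr0Sn R 1)) fA.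
Qed.

(** The value is affine in [c]: moving this root to y changes it by (c - y) times the value at
    [root_poly R s]. *)
Lemma moment_functional_cons (R : realType) (f : nat -> R) c s :
  moment_functional f (root_poly R (c :: s)) =
  moment_functional f ('X * root_poly R s)
  - c%:R * moment_functional f (root_poly R s).
Proof.
by rewrite root_poly_cons mulrBl mul_polyC moment_functionalB moment_functionalZ.
Qed.

(* If the weight at c were negative, replace the root c by the nearest y, on the
   side where R := root_poly s stays of the wrong sign, beyond which (x - y) R(x)
   is still nonnegative on the integers: the value would decrease.  When there
   is no such y, R itself is nonnegative, of degree one less. *)
Lemma minimal_roots_weight_ge0 (R : realType) (f : nat -> R) c s :
  minimal_roots f (c :: s) ->
  (nonneg_roots R s -> 0 < moment_functional f (root_poly R s)) ->
  0 <= moment_functional f (root_poly R s) / (root_poly R s).[c%:R].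
Proof.
move=> [[/= /andP[cs us] s0] smin] fs.
set P := root_poly R s in s0 fs *; set v := moment_functional f P in fs *.
have sgn x : 0 <= (x%:R - c%:R) * P.[x%:R] by rewrite -horner_root_poly_cons.
have up (x : nat) : (c < x)%N -> 0 <= P.[x%:R].
  by move=> cx; have := sgn x; rewrite pmulr_rge0 // subr_gt0 ltr_nat.
have down (x : nat) : (x < c)%N -> P.[x%:R] <= 0.
  by move=> xc; have := sgn x; rewrite nmulr_rge0 // subr_lt0 ltr_nat.
have pivot y : y \notin s ->
    (forall x : nat, 0 <= (x%:R - y%:R) * P.[x%:R]) -> (c%:R - y%:R) * v >= 0.
  move=> ys yP; have := smin (y :: s); rewrite !moment_functional_cons -/P -/v.
  move/(_ _ erefl); rewrite lerD2l lerN2 -subr_ge0 -mulrBl; apply.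
  by split=> [|x]; rewrite /= ?ys // horner_root_poly_cons.
have notin y : P.[y%:R] != 0 -> y \notin s by rewrite -(root_root_poly R).
have Pc : P.[c%:R] != 0 by rewrite -rootE root_root_poly.
case: (ltgtP P.[c%:R] 0) Pc => // [Pc|Pc] _.
- rewrite nmulr_lge0 ?invr_lt0 //.
  have exy : exists y, (c < y)%N && (0 < P.[y%:R]).
    exists (maxn c (\max_(d <- s) d)).+1; rewrite ltnS leq_maxl /=.
    apply: root_poly_gt0; apply/allP => b bs; rewrite ltnS leq_max.
    have -> : (b <= \max_(d <- s) d)%N by exact: leq_bigmax_seq.
    exact: orbT.
  case: (ex_minnP exy) => y /andP[cy Py] ymin.
  rewrite -(nmulr_rge0 _ (_ : c%:R - y%:R < 0)); last first.
    by rewrite subr_lt0 ltr_nat.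
  apply: pivot => [|x]; first by apply: notin; rewrite gt_eqF.
  have [xy|yx] := ltnP x y; last first.
    rewrite mulr_ge0 ?subr_ge0 ?ler_nat // up //; exact: leq_trans yx.
  rewrite mulr_le0 ?subr_le0 ?ler_nat //; first exact: ltnW.
  case: (ltngtP x c) => [/down //|cx|->]; last exact: ltW.
  rewrite leNgt; apply/negP => Px.
  by have := ymin x; rewrite cx Px => /(_ isT); rewrite leqNgt xy.
rewrite pmulr_lge0 ?invr_gt0 //.
(* Below [c] the search for y may fail, whereas above [c] it succeeds because [P] is positive beyond
   all its roots. *)
have [[y /andP[yc Py]]|noy] := pselect (exists y, (y < c)%N && (P.[y%:R] < 0)).
  have exy : exists y, (y < c)%N && (P.[y%:R] < 0) by exists y; rewrite yc.
  have bnd z : (z < c)%N && (P.[z%:R] < 0) -> (z <= c)%N by case/andP => /ltnW.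
  case: (ex_maxnP exy bnd) => {yc Py}y /andP[yc Py] ymax.
  rewrite -(pmulr_rge0 _ (_ : 0 < c%:R - y%:R)); last by rewrite subr_gt0 ltr_nat.
  apply: pivot => [|x]; first by apply: notin; rewrite lt_eqF.
  have [xy|yx] := leqP x y.
    rewrite mulr_le0 ?subr_le0 ?ler_nat // down //; exact: leq_ltn_trans yc.
  rewrite mulr_ge0 ?subr_ge0 ?ler_nat //; first exact: ltnW.
  case: (ltngtP x c) => [xc|/up //|->]; last exact: ltW.
  rewrite leNgt; apply/negP => Px.
  by have := ymax x; rewrite xc Px => /(_ isT); rewrite leqNgt yx.
apply/ltW/fs; split=> // x.
case: (ltngtP x c) => [xc|/up //|->]; last exact: ltW.
by rewrite leNgt; apply/negP => Px; apply: noy; exists x; rewrite xc.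
Qed.

(** * Lagrange interpolation and finitely supported measures *)

Lemma moment_functional_sum (R : realType) (f : nat -> R) (I : Type) (r : seq I)
    (F : I -> {poly R}) :
  moment_functional f (\sum_(i <- r) F i) = \sum_(i <- r) moment_functional f (F i).
Proof.
elim: r => [|i r ih]; last by rewrite !big_cons moment_functionalD ih.
by rewrite !big_nil -(scale0r 0) moment_functionalZ mul0r.
Qed.

(** Up to scaling, the polynomials [root_poly R (rem c s)] are the Lagrange basis at the nodes [s].
    [Q] minus its interpolant vanishes at more points than its degree allows, hence is zero. *)
Lemma moment_functional_lagrange (R : realType) (f : nat -> R) s (Q : {poly R}) :
  uniq s -> (size Q <= size s)%N ->
  moment_functional f Q =
  \sum_(c <- s) moment_functional f (root_poly R (rem c s))
                / (root_poly R (rem c s)).[c%:R] * Q.[c%:R].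
Proof.
move=> us Qs.
pose G c := Q.[c%:R] / (root_poly R (rem c s)).[c%:R] *: root_poly R (rem c s).
have Q_eq : Q = \sum_(c <- s) G c.
  apply/eqP; rewrite -subr_eq0; apply/eqP.
  apply: (@roots_geq_poly_eq0 _ _ [seq c%:R | c <- s]); last 2 first.
  - by rewrite map_inj_uniq //; exact/mulrIn/oner_neq0.
  - rewrite size_map; apply: leq_trans (size_polyD _ _) _.
    rewrite geq_max Qs size_polyN; apply: leq_trans (size_sum _ _ _) _.
    apply/bigmax_leqP_seq => c cs _; apply: leq_trans (size_scale_leq _ _) _.
    by rewrite size_root_poly size_rem // prednK //; case: (s) cs.
  apply/allP => _ /mapP[c cs ->]; rewrite rootE hornerD hornerN horner_sum.
  rewrite (bigD1_seq c) //= big1_seq ?addr0 => [|b /andP[bc bs]].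
    have Rc : (root_poly R (rem c s)).[c%:R] != 0.
      by rewrite -rootE root_root_poly mem_rem_uniqF.
    by rewrite hornerZ divfK ?subrr.
  have /rootP Rb : root (root_poly R (rem b s)) c%:R.
    by rewrite root_root_poly mem_rem_uniq // inE eq_sym bc.
  by rewrite hornerZ Rb mulr0.
rewrite {1}Q_eq moment_functional_sum; apply: eq_bigr => c _.
by rewrite moment_functionalZ; ring.
Qed.

Lemma size_sub_monic (R : realType) (P Q : {poly R}) n :
  P \is monic -> Q \is monic -> size P = n.+1 -> size Q = n.+1 ->
  (size (P - Q)%R <= n)%N.
Proof.
move=> Pm Qm Pn Qn; apply/leq_sizeP => j; rewrite leq_eqVlt => /orP[/eqP <-|nj].
  have -> : n = (size P).-1 by rewrite Pn.
  have := monicP Pm; rewrite /lead_coef coefB => ->.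
  have := monicP Qm; rewrite /lead_coef Qn Pn /= => ->; exact: subrr.
by rewrite coefB !nth_default ?subrr ?Pn ?Qn.
Qed.

(** A pair [(a, x)] stands for a mass [a] at the point [x]. *)
Definition atomic_moment (R : realType) (t : seq (R * nat)) (k : nat) : R :=
  \sum_(p <- t) p.1 * p.2%:R ^+ k.

(** Index 0 is included and the total mass [f 0] is left free, so that these sequences form a convex
    cone. *)
Definition atomic (R : realType) (f : nat -> R) n : Prop :=
  exists2 t : seq (R * nat), all (fun p => 0 <= p.1) t &
    forall k, (k <= n)%N -> f k = atomic_moment t k.

Lemma eq_atomic (R : realType) (f g : nat -> R) n :
  (forall k, (k <= n)%N -> f k = g k) -> atomic f n -> atomic g n.
Proof. by move=> fg [t t0 ft]; exists t => // k kn; rewrite -fg // ft. Qed.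

Lemma atomicD (R : realType) (f g : nat -> R) n :
  atomic f n -> atomic g n -> atomic (fun k => f k + g k) n.
Proof.
move=> [t t0 ft] [u u0 gu]; exists (t ++ u); first by rewrite all_cat t0.
by move=> k kn; rewrite ft // gu // /atomic_moment big_cat.
Qed.

Lemma atomicZ (R : realType) (f : nat -> R) n a :
  0 <= a -> atomic f n -> atomic (fun k => a * f k) n.
Proof.
move=> a0 [t t0 ft]; exists [seq (a * p.1, p.2) | p <- t].
  by rewrite all_map; apply: sub_all t0 => p p0; exact: mulr_ge0.
move=> k kn; rewrite ft // /atomic_moment big_map mulr_sumr.
by apply: eq_bigr => p _; rewrite mulrA.
Qed.

Lemma atomic_exp (R : realType) (x n : nat) : atomic (fun k => x%:R ^+ k : R) n.
Proof.
exists [:: (1, x)]; rewrite /= ?ler01 // => k _.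
by rewrite /atomic_moment big_seq1 mul1r.
Qed.

Lemma moment_functional_atomic (R : realType) (t : seq (R * nat)) P :
  moment_functional (atomic_moment t) P = \sum_(p <- t) p.1 * P.[p.2%:R].
Proof.
transitivity (\sum_(k < size P) \sum_(p <- t) p.1 * (P`_k * p.2%:R ^+ k)).
  apply: eq_bigr => k _; rewrite /atomic_moment mulr_sumr.
  by apply: eq_bigr => p _; rewrite mulrCA.
by rewrite exchange_big; apply: eq_bigr => p _; rewrite horner_coef mulr_sumr.
Qed.

Lemma atomic_of_minimal_roots (R : realType) (f : nat -> R) s :
  (0 < size s)%N -> minimal_roots f s -> positive_upto f (size s).-1 ->
  atomic (fun k => if (k < size s)%N then f k
                   else f k - moment_functional f (root_poly R s)) (size s).
Proof.
move=> s_gt0 smin fs; have [us _] := smin.1.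
pose w c := moment_functional f (root_poly R (rem c s))
            / (root_poly R (rem c s)).[c%:R].
exists [seq (w c, c) | c <- s].
  rewrite all_map; apply/allP => c cs /=.
  have sE := perm_to_rem cs.
  apply: minimal_roots_weight_ge0 => [|r0]; last first.
    by apply: fs => //; rewrite size_rem.
  split; first exact: perm_nonneg_roots smin.1.
  move=> t t0; rewrite -(perm_size sE) -(perm_root_poly R sE).
  exact: smin.2.
have wE (Q : {poly R}) : (size Q <= size s)%N ->
    moment_functional f Q = \sum_(c <- s) w c * Q.[c%:R].
  exact: moment_functional_lagrange.
move=> k; rewrite /atomic_moment big_map leq_eqVlt => /orP[/eqP ->|ks].
  (* In the top degree, interpolate X^n minus [root_poly R s]: it has lower degree and takes the
     same values as X^n at the nodes. *)
  rewrite ltnn -(moment_functionalXn f (size s)) -moment_functionalB wE.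
    apply: eq_big_seq => c cs; rewrite hornerD hornerN hornerXn.
    have /rootP -> : root (root_poly R s) c%:R by rewrite root_root_poly.
    by rewrite subr0.
  apply: size_sub_monic; rewrite ?monicXn ?monic_root_poly ?size_polyXn //.
  exact: size_root_poly.
rewrite ks -(moment_functionalXn f k) wE ?size_polyXn //.
by apply: eq_bigr => c _; rewrite hornerXn.
Qed.

(* Subtracting a mass e at a far point N keeps the lower moments in the positive
   cone as soon as e is of order N ^ (1 - n), so that the n-th moment of the
   removed mass is of order N. *)
Lemma atomic_raise (R : realType) (f : nat -> R) n K :
  positive_upto f n.+1 ->
  exists g, [/\ atomic g n.+2, forall k, (k < n.+2)%N -> g k = f k & K <= g n.+2].
Proof.
move=> fn; have [d d0 fd] := coercive_upto fn.
(* As 1 + N <= 2 N, this gives e N^(n + 2) >= d N / 2^(n + 2) >= |K|. *)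
pose N := (Num.bound (2 ^+ n.+2 * `|K| / d)).+1.
have N0 : 0 < 1 + N%:R :> R by rewrite addrC natr1.
(* By [horner_root_poly_le], removing the mass [e] at [N] costs at most half of the coercive lower
   bound. *)
pose e := d / 2 / (1 + N%:R) ^+ n.+1.
have e0 : 0 < e by rewrite !divr_gt0 // exprn_gt0.
pose h k : R := f k - e * N%:R ^+ k.
have hn : positive_upto h n.+1.
  move=> s sn s0.
  have -> : moment_functional h (root_poly R s) =
      moment_functional f (root_poly R s) - e * (root_poly R s).[N%:R].
    rewrite -(moment_functional_exp N%:R) -[X in X - _]mul1r -mulNr.
    rewrite -moment_functional_lin.
    by apply: eq_bigr => k _; rewrite mul1r mulNr.
  have W0 := root_weight_gt0 R s.
  rewrite subr_gt0; apply: lt_le_trans (fd s s0 sn).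
  apply: (@le_lt_trans _ _ (d / 2 * root_weight R s)).
    rewrite /e -mulrA ler_pM2l ?divr_gt0 // ler_pdivrMl ?exprn_gt0 //.
    apply: le_trans (ler_norm _) _; apply: le_trans (horner_root_poly_le R s N) _.
    by rewrite ler_pM2r // ler_weXn2l // lerDl.
  by rewrite ltr_pM2r //; lra.
have [s smin sn] := minimal_roots_exists (positive_uptoW (leqnSn n) hn).
have h_at : atomic (fun k => if (k < n.+2)%N then h k
                   else h k - moment_functional h (root_poly R s)) n.+2.
  by rewrite -sn; apply: atomic_of_minimal_roots => //; rewrite sn.
have g_at := atomicD h_at (atomicZ (ltW e0) (atomic_exp R N n.+2)).
eexists; split; first exact: g_at.
  by move=> k kn /=; rewrite kn /h subrK.
(* The measure obtained for [h] has a nonnegative top moment, whatever the sign of the minimum, so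
   the mass at [N] alone yields the bound. *)
case: h_at => t t0 /(_ n.+2 (leqnn _)) -> /=.
have {}t0 : 0 <= atomic_moment t n.+2.
  rewrite /atomic_moment big_seq sumr_ge0 // => p /(allP t0) p0.
  by rewrite mulr_ge0 // exprn_ge0.
apply: (@le_trans _ _ (e * N%:R ^+ n.+2)); last by rewrite lerDr.
have N1 : 1 <= N%:R :> R by rewrite ler1n.
have dK : 2 ^+ n.+2 * `|K| <= N%:R * d.
  rewrite -ler_pdivrMr //.
  have X0 : 0 <= 2 ^+ n.+2 * `|K| / d.
    by apply: divr_ge0 (ltW d0); apply: mulr_ge0 => //; exact: exprn_ge0.
  by apply: le_trans (ltW (archi_boundP X0)) _; rewrite ler_nat.
apply: le_trans (ler_norm _) _.
have : (1 + N%:R) ^+ n.+1 <= (2 * N%:R) ^+ n.+1 :> R.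
  by rewrite lerXn2r ?nnegrE; lra.
rewrite exprMn /e => hN.
rewrite mulrAC ler_pdivlMr ?exprn_gt0 //.
apply: (@le_trans _ _ (`|K| * (2 ^+ n.+1 * N%:R ^+ n.+1))); first exact: ler_wpM2l.
rewrite [N%:R ^+ n.+2]exprS mulrA (mulrA (d / 2)) ler_pM2r ?exprn_gt0 //.
by rewrite exprS in dK; lra.
Qed.

Lemma atomic_of_minimum_ge0 (R : realType) (f : nat -> R) n s :
  positive_upto f n.+1 -> minimal_roots f s -> size s = n.+2 ->
  0 <= moment_functional f (root_poly R s) -> atomic f n.+2.
Proof.
move=> fn smin sn; set v := moment_functional _ _ => v0.
have := atomic_of_minimal_roots (s := s) _ smin; rewrite sn -/v => /(_ isT fn) f1.
have [g [g_at gf gn]] := atomic_raise (f n.+2) fn.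
have [v_eq0|v_neq0] := eqVneq v 0.
  by apply: eq_atomic f1 => k _; rewrite v_eq0 subr0 if_same.
have {}v0 : 0 < v by rewrite lt_def v_neq0.
(* The two top moments are f - v and f - v + w; their average with weights (w - v) / w and v / w is
   f. *)
pose w := g n.+2 - f n.+2 + v.
have w0 : 0 < w by rewrite /w; lra.
have w1 : 0 <= w - v by rewrite /w; lra.
apply: eq_atomic (atomicD (atomicZ (divr_ge0 w1 (ltW w0)) f1)
                          (atomicZ (divr_ge0 (ltW v0) (ltW w0)) g_at)).
move=> k kn; case: ltnP => [kn'|nk].
  by rewrite gf //; field; rewrite gt_eqF.
have -> : k = n.+2 by apply/eqP; rewrite eqn_leq kn.
by have -> : g n.+2 = w + f n.+2 - v; [rewrite /w; ring|field; rewrite gt_eqF].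
Qed.

(** * Realizing measures *)

Lemma atomic_measure_exists (R : realType) (t : seq (R * nat)) :
  all (fun p => 0 <= p.1) t ->
  exists mu : {measure set nat -> \bar R}, forall h : nat -> \bar R,
    (forall x, 0 <= h x)%E ->
    (\int[mu]_x h x = \sum_(p <- t) p.1%:E * h p.2)%E.
Proof.
elim: t => [_|[a c] t IH /= /andP[a0 /IH[mu muE]]].
  by exists mzero => h h0; rewrite big_nil integral_measure_zero.
exists (measure_add (mscale (NngNum a0) \d_c) mu) => h h0.
rewrite ge0_integral_measure_add // big_cons /= muE // ge0_integral_mscale //.
by rewrite integral_dirac // diracT mul1e.
Qed.

Lemma atomic_realizable (R : realType) (m : seq R) :
  atomic (moment m) (size m) -> realizable m.
Proof.
move=> [t t0 mt]; have [mu muE] := atomic_measure_exists t0.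
have muX k : (k <= size m)%N -> (\int[mu]_x ((x%:R : R) ^+ k)%:E = (moment m k)%:E)%E.
  move=> km; rewrite muE => [|x]; last by rewrite lee_fin exprn_ge0.
  by rewrite mt // /atomic_moment -sumEFin; apply: eq_bigr => p _; rewrite EFinM.
have mu1 : mu setT = 1%E.
  have := muX 0%N isT; rewrite /moment /=.
  by under eq_integral do rewrite expr0; rewrite integral_cst // mul1e.
(* The total mass is already 1; [mnormalize] only supplies the probability structure. *)
exists (mnormalize mu \d_0%N) => k /andP[_ km].
rewrite -muX //; congr (integral _ _ _); apply/funext => U /=.
by rewrite /mnormalize mu1 onee_eq0 /= invr1 mule1.
Qed.

Lemma realizable_integral (R : realType) (m : seq R) : realizable m ->
  exists mu : probability nat R, forall P : {poly R}, (size P <= (size m).+1)%N ->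
    mu.-integrable setT (fun x => (P.[x%:R])%:E) /\
    (\int[mu]_x (P.[x%:R])%:E = (moment_functional (moment m) P)%:E)%E.
Proof.
move=> [mu mum]; exists mu => P Pm.
have muX k : (k <= size m)%N -> (\int[mu]_x ((x%:R : R) ^+ k)%:E = (moment m k)%:E)%E.
  case: k => [|k] km; last exact: mum.
  under eq_integral do rewrite expr0; rewrite integral_cst // mul1e.
  exact: probability_setT.
(* Powers are nonnegative on [nat], so a finite integral already means integrability. *)
have iX k : (k <= size m)%N -> mu.-integrable setT (fun x => ((x%:R : R) ^+ k)%:E).
  move=> km; apply/integrableP; split => //.
  under eq_integral => x _ do rewrite abse_EFin ger0_norm ?exprn_ge0 //.
  by rewrite muX // ltry.
have iP (k : 'I_(size P)) :
    mu.-integrable setT (fun x => (P`_k)%:E * ((x%:R : R) ^+ k)%:E)%E.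
  apply: integrableZl => //; apply: iX; rewrite -ltnS; exact: leq_trans Pm.
have -> : (fun x : nat => (P.[x%:R])%:E) =
    (fun x => \sum_(k < size P) (P`_k)%:E * ((x%:R : R) ^+ k)%:E)%E.
  apply/funext => x; rewrite horner_coef -sumEFin.
  by apply: eq_bigr => k _; rewrite EFinM.
split; first exact: integrable_sum.
rewrite integral_sum //; rewrite -sumEFin; apply: eq_bigr => k _.
have km : (k <= size m)%N by rewrite -ltnS; exact: leq_trans Pm.
by rewrite integralZl ?muX //; exact: iX.
Qed.

Lemma realizable_ge0 (R : realType) (m : seq R) (P : {poly R}) : realizable m ->
  (size P <= (size m).+1)%N -> (forall x : nat, 0 <= P.[x%:R]) ->
  0 <= moment_functional (moment m) P.
Proof.
move=> /realizable_integral[mu muP] /muP[_ PE] P0.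
by rewrite -lee_fin -PE integral_ge0 // => x _; rewrite lee_fin.
Qed.

(** A nonnegative function with zero integral vanishes almost everywhere, so the measure is carried
    by [s], and the weights are the masses of its points. *)
Lemma realizable_atomic (R : realType) (m : seq R) s : realizable m ->
  nonneg_roots R s -> (size s <= size m)%N ->
  moment_functional (moment m) (root_poly R s) = 0 ->
  exists2 w : nat -> R, forall c, 0 <= w c & forall k, (k <= size m)%N ->
    moment m k = atomic_moment [seq (w c, c) | c <- s] k.
Proof.
move=> /realizable_integral[mu muP] [us s0] sm Ls0.
exists (fun c => fine (mu [set c]%classic)) => [c|k km]; first exact: fine_ge0.
have ae_s : {ae mu, forall x, x \in s}.
  have [] := muP (root_poly R s); rewrite ?size_root_poly // Ls0 => _ Pint0.
  have : ae_eq mu setT (fun x : nat => ((root_poly R s).[x%:R])%:E) (cst 0%E).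
    apply/ae_eq_integral_abs => //; rewrite -[RHS]Pint0.
    by apply: eq_integral => x _; rewrite abse_EFin ger0_norm.
  apply: filterS => x /(_ Logic.I) [] /eqP.
  by rewrite -rootE root_root_poly.
have [] := muP 'X^k; rewrite ?size_polyXn // moment_functionalXn => _ Xint.
apply: EFin_inj; rewrite -Xint.
rewrite (@ge0_ae_eq_integral _ _ _ mu setT _
  (fun x => \sum_(c <- s) (c%:R ^+ k)%:E * (\1_[set c]%classic x)%:E)%E) //; last 3 first.
- by move=> x _; rewrite lee_fin hornerXn exprn_ge0.
- by move=> x _; apply: sume_ge0 => c _; rewrite -EFinM lee_fin mulr_ge0 // exprn_ge0.
- apply: filterS ae_s => x xs _; rewrite (bigD1_seq x) //= big1 ?adde0 => [|c cx].
    by rewrite hornerXn indicE mem_set // mule1.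
  by rewrite indicE memNset ?mule0 // => xc; rewrite xc eqxx in cx.
rewrite ge0_integral_sum //.
rewrite /atomic_moment big_map -sumEFin; apply: eq_bigr => c _.
rewrite ge0_integralZl ?lee_fin ?exprn_ge0 //.
rewrite integral_indic // setIT muleC EFinM fineK //.
exact: fin_num_measure.
Qed.

(** * Translation of [L], [calP] and I-realizability into root lists *)

Lemma L_moment_functional (R : realType) (m : seq R) (P : {poly R}) :
  L P m = moment_functional (moment m) P.
Proof.
have [Pm|mP] := leqP (size P) (size m).+1.
  by rewrite (moment_functional_widen _ Pm).
rewrite /moment_functional /L.
rewrite (big_ord_widen (size P) (fun k => P`_k * moment m k)) 1?ltnW //.
rewrite big_mkcond /=; apply: eq_bigr => i _; case: ltnP => // mi.
(* Beyond the length of [m], [moment] takes the default value 0, matching the coefficients that [L]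
   ignores. *)
by have -> : moment m i = 0; rewrite ?mulr0 // /moment nth_default.
Qed.

(** A monic polynomial of degree k with k distinct roots is the product of its linear factors. *)
Lemma calPP (R : realType) k (P : {poly R}) :
  calP k P <-> exists s, [/\ nonneg_roots R s, size s = k & P = root_poly R s].
Proof.
split=> [[Pm Pk [s [us sk sP]] P0]|[s [[us s0] sk ->]]]; last first.
  split=> //; rewrite ?monic_root_poly ?size_root_poly ?sk //.
  by exists s; split=> // a; rewrite root_root_poly.
have PE : P = root_poly R s.
  rewrite [LHS](all_roots_prod_XsubC (rs := [seq c%:R | c <- s])).
  - by rewrite (monicP Pm) scale1r big_map.
  - by rewrite size_map sk.
  - by apply/allP => _ /mapP[c cs ->]; exact: sP.
  - by rewrite uniq_rootsE map_inj_uniq //; exact/mulrIn/oner_neq0.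
by exists s; split=> //; split=> // x; rewrite -PE.
Qed.

Lemma moment_take (R : realType) (m : seq R) j k :
  (k <= j)%N -> moment (take j m) k = moment m k.
Proof. by rewrite /moment; case: k => //= k kj; rewrite nth_take. Qed.

Lemma moment_functional_take (R : realType) (m : seq R) j (P : {poly R}) :
  (size P <= j.+1)%N ->
  moment_functional (moment (take j m)) P = moment_functional (moment m) P.
Proof. by move=> Pj; apply: eq_moment_functional Pj _ => k kj; exact: moment_take. Qed.

Lemma realizable_take (R : realType) (m : seq R) j :
  realizable m -> realizable (take j m).
Proof.
move=> [mu mum]; exists mu => k /andP[k0]; rewrite size_take_min leq_min => /andP[kj km].
by rewrite moment_take // mum ?k0.
Qed.

Lemma nonneg_roots_cons2 (R : realType) s : nonneg_roots R s ->
  exists a, nonneg_roots R [:: a.+1, a & s].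
Proof.
move=> s0; exists (\max_(c <- s) c).+1; apply: nonneg_roots_pair => //.
by apply/allP => c cs; rewrite ltnS; exact: leq_bigmax_seq.
Qed.

(* A measure annihilating a polynomial is carried by its roots, so it also
   annihilates every polynomial having more roots. *)
Lemma realizable_vanish_cat (R : realType) (m : seq R) s t : realizable m ->
  nonneg_roots R s -> (size (t ++ s) <= size m)%N ->
  moment_functional (moment m) (root_poly R s) = 0 ->
  moment_functional (moment m) (root_poly R (t ++ s)) = 0.
Proof.
move=> mr s0 tsm Ls0.
have sm : (size s <= size m)%N by apply: leq_trans tsm; rewrite size_cat leq_addl.
have [w w0 mw] := realizable_atomic mr s0 sm Ls0.
rewrite (eq_moment_functional (N := (size m).+1) _ mw) ?size_root_poly //.
rewrite moment_functional_atomic big_map big_seq big1 // => c cs.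
have /rootP -> : root (root_poly R (t ++ s)) c%:R.
  by rewrite root_root_poly mem_cat cs orbT.
exact: mulr0.
Qed.

(** Descending induction in steps of two from degrees n and n - 1. If the functional vanished at
    [s], it would also vanish after adding a pair of roots, against positivity two degrees
    higher. *)
Lemma I_realizable_positive_upto (R : realType) (m : seq R) :
  I_realizable m -> positive_upto (moment m) (size m).
Proof.
move=> [mr mI] s; have [N] := ubnP (size m - size s).
elim: N s => // N IH s sN sm s0.
have top : (size s = size m \/ size s = (size m).-1) ->
    0 < moment_functional (moment m) (root_poly R s).
  move=> sE; rewrite -L_moment_functional; apply: mI.
  by case: sE => <-; [left|right]; apply/calPP; exists s.
have [sE|sE] := eqVneq (size s) (size m); first by apply: top; left.
have [sE1|sE1] := eqVneq (size s) (size m).-1; first by apply: top; right.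
have [a as0] := nonneg_roots_cons2 s0.
have asm : (size [:: a.+1, a & s] <= size m)%N by rewrite /=; lia.
rewrite lt_def realizable_ge0 ?size_root_poly ?andbT //; last exact: s0.2.
apply/eqP => Ls0.
have lt_N : (size m - size [:: a.+1, a & s] < N)%N by rewrite /=; lia.
have := IH _ lt_N asm as0.
by rewrite (realizable_vanish_cat (t := [:: a.+1; a]) mr s0 asm Ls0) ltxx.
Qed.

Lemma minimizingP (R : realType) (m : seq R) (P : {poly R}) :
  minimizing m P <->
  exists s, [/\ minimal_roots (moment m) s, size s = size m & P = root_poly R s].
Proof.
split=> [[/calPP[s [s0 sm ->]] Pmin]|[s [[s0 smin] sm ->]]].
  exists s; split=> //; split=> // t t0 ts.
  by rewrite -!L_moment_functional; apply: Pmin; apply/calPP; exists t; rewrite ts.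
split; first by apply/calPP; exists s.
move=> _ /calPP[t [t0 tm ->]]; rewrite !L_moment_functional.
by apply: smin; rewrite ?sm.
Qed.

(** * Vectors of length one, and extensions of B-realizable vectors *)

Lemma realizable_deg1 (R : realType) (m : seq R) :
  size m = 1%N -> 0 <= moment m 1 -> realizable m.
Proof.
move=> m1 x0; set x := moment m 1 in x0.
(* A mass x / N at a point N >= x, with the rest at 0, has mean x. *)
pose N := (Num.bound x).+1.
have N0 : 0 < N%:R :> R by [].
have xN : x / N%:R <= 1.
  rewrite ler_pdivrMr // mul1r; apply: le_trans (ltW (archi_boundP x0)) _.
  by rewrite ler_nat.
apply: atomic_realizable; rewrite m1.
have N1 : 0 <= 1 - x / N%:R by rewrite subr_ge0.
apply: eq_atomic (atomicD (atomicZ N1 (atomic_exp R 0 1))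
  (atomicZ (divr_ge0 x0 (ltW N0)) (atomic_exp R N 1))) => -[|[|]] // _.
  by rewrite !expr0 /moment /= !mulr1 subrK.
by rewrite !expr1 mulr0n mulr0 add0r divfK ?gt_eqF.
Qed.

(** The measure is carried by the roots [s], where the multiple by a power of X vanishes too. *)
Lemma realizable_vanish_mulXn (R : realType) (m : seq R) s i : realizable m ->
  nonneg_roots R s -> (size s + i)%N = size m ->
  moment_functional (moment m) (root_poly R s) = 0 ->
  moment_functional (moment m) ('X^i * root_poly R s) = 0.
Proof.
move=> mr s0 sim Ls0.
have sm : (size s <= size m)%N by rewrite -sim leq_addr.
have [w w0 mw] := realizable_atomic mr s0 sm Ls0.
rewrite (eq_moment_functional (N := (size m).+1) _ mw); last first.
  by rewrite mulrC size_mulXn ?monic_neq0 ?monic_root_poly // size_root_poly -sim; lia.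
rewrite moment_functional_atomic big_map big_seq big1 // => c cs.
have /rootP Rc : root (root_poly R s) c%:R by rewrite root_root_poly.
by rewrite hornerM Rc !mulr0.
Qed.

(** The measure realizing the truncation is carried by [s], so it has moments of all orders. Both it
    and [m] annihilate a monic polynomial of degree n, which fixes the n-th moment from the lower
    ones. *)
Lemma realizable_of_vanish_mulXn (R : realType) (m : seq R) s i :
  (0 < i)%N -> realizable (take (size m).-1 m) ->
  nonneg_roots R s -> (size s + i)%N = size m ->
  moment_functional (moment m) (root_poly R s) = 0 ->
  moment_functional (moment m) ('X^i * root_poly R s) = 0 -> realizable m.
Proof.
move=> i0 mr s0 sim Ls0 LX0; set n := size m in mr sim.
have n0 : (0 < n)%N by lia.
have sz : size (take n.-1 m) = n.-1 by rewrite size_takel // -/n; lia.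
have sm : (size s <= size (take n.-1 m))%N by rewrite sz; lia.
rewrite -(@moment_functional_take _ m n.-1) in Ls0; last first.
  by rewrite size_root_poly; lia.
have [w w0 mw] := realizable_atomic mr s0 sm Ls0.
rewrite sz in mw; set t := [seq _ | _ <- _] in mw.
have {}mw k : (k < n)%N -> moment m k = atomic_moment t k.
  by move=> kn; rewrite -mw ?moment_take //; lia.
apply: atomic_realizable; rewrite -/n; exists t.
  by rewrite all_map; apply/allP => c _ /=; exact: w0.
move=> k; rewrite leq_eqVlt => /orP[/eqP -> {k}|]; last exact: mw.
have tX0 : moment_functional (atomic_moment t) ('X^i * root_poly R s) = 0.
  rewrite moment_functional_atomic big_map big_seq big1 // => c cs.
  have /rootP Rc : root (root_poly R s) c%:R by rewrite root_root_poly.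
  by rewrite hornerM Rc !mulr0.
(* Subtract from X^n the annihilated monic polynomial: the difference has degree below n, where the
   two functionals agree. *)
rewrite -[LHS]moment_functionalXn -[RHS]moment_functionalXn.
rewrite -[LHS]subr0 -[in LHS]LX0 -[RHS]subr0 -[in RHS]tX0 -!moment_functionalB.
apply: eq_moment_functional mw; apply: size_sub_monic.
- exact: monicXn.
- by rewrite monicMr ?monicXn ?monic_root_poly.
- exact: size_polyXn.
- rewrite mulrC size_mulXn ?monic_neq0 ?monic_root_poly // size_root_poly.
  by rewrite addnS addnC sim.
Qed.

Theorem theorem4p4 (R : realType) (n : nat) (hn : (1 <= n)%N)
    (m : n.-tuple R) :
  [/\ (* (a) *)
      n = 1%N ->
        [/\ 0 < moment m 1 -> I_realizable m,
            moment m 1 = 0 -> B_realizable m &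
            moment m 1 < 0 -> ~ realizable m],
      (* (b) *)
      (2 <= n)%N -> ~ realizable (take n.-1 m) -> ~ realizable m,
      (* (c) *)
      (2 <= n)%N -> I_realizable (take n.-1 m) ->
        (exists P : {poly R}, minimizing m P) /\
        (forall P : {poly R}, minimizing m P ->
           [/\ realizable m <-> 0 <= L P m,
               0 < L P m -> I_realizable m &
               L P m = 0 -> B_realizable m]) &
      (* (d) *)
      (2 <= n)%N -> B_realizable (take n.-1 m) ->
        (exists (i : nat) (P : {poly R}),
           [/\ i = 1%N \/ i = 2%N, calP (n - i) P & L P m = 0]) /\
        (forall (i : nat) (P : {poly R}),
           i = 1%N \/ i = 2%N -> calP (n - i) P -> L P m = 0 ->
           (realizable m <-> L ('X^i * P) m = 0) /\
           (B_realizable m <-> L ('X^i * P) m = 0))].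
Proof.
have sm : size m = n by rewrite size_tuple.
have takeE (P : {poly R}) : (size P <= n)%N -> L P (take n.-1 m) = L P m.
  by move=> Pn; rewrite !L_moment_functional moment_functional_take // prednK.
have sz : size (take n.-1 m) = n.-1 by rewrite size_takel // sm leq_pred.
split.
- move=> n1; have sm1 : size m = 1%N by rewrite sm.
  have LX : moment_functional (moment m) (root_poly R [:: 0%N]) = moment m 1.
    by rewrite /root_poly big_seq1 subr0 -['X]expr1 moment_functionalXn.
  have r0 : nonneg_roots R [:: 0%N] by exact/nonneg_roots1.
  split=> [x0|x0|].
  + split=> [|P]; first by apply: realizable_deg1; rewrite ?sm1 // ltW.
    rewrite sm1 L_moment_functional.
    case=> /calPP[s [s0 s1 ->]].
      by case: s s1 s0 => [|c []] // _ /nonneg_roots1 ->; rewrite LX.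
    by case: s s1 {s0} => // _; rewrite /root_poly big_nil moment_functionalC.
  + split; first by apply: realizable_deg1; rewrite ?sm1 // x0.
    exists (root_poly R [:: 0%N]); rewrite L_moment_functional LX sm1; split=> //.
    by left; apply/calPP; exists [:: 0%N].
  + rewrite ltNge => /negP x0 mr; apply: x0; rewrite -LX.
    by apply: realizable_ge0 r0.2; rewrite ?size_root_poly ?sm1.
- by move=> _ nr /(@realizable_take _ _ n.-1).
- move=> n2 mI.
  have mpos : positive_upto (moment m) n.-1.
    move=> s sn s0; rewrite -(@moment_functional_take _ m n.-1) ?size_root_poly //.
    by apply: I_realizable_positive_upto; rewrite ?sz.
  have [k nE] : exists k, n = k.+2 by exists n.-2; lia.
  have smk : size m = k.+2 by rewrite sm.
  have n1E : n.-1 = k.+1 by rewrite nE.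
  rewrite n1E in mpos.
  split.
    have [s smin sk] := minimal_roots_exists (positive_uptoW (leqnSn k) mpos).
    by exists (root_poly R s); apply/minimizingP; exists s; rewrite smk.
  move=> P /[dup] Pmin /minimizingP[s [smin]]; rewrite smk => sn PE.
  have real_iff : realizable m <-> 0 <= L P m.
    rewrite L_moment_functional PE; split=> [mr|P0].
      by apply: realizable_ge0 smin.1.2; rewrite // size_root_poly sn smk.
    apply: atomic_realizable; rewrite smk.
    by apply: atomic_of_minimum_ge0 mpos smin sn P0.
  split=> // [P0|P0].
    split=> [|Q]; first exact/real_iff/ltW.
    (* Degree n is controlled by minimality, degree n - 1 by I-realizability of the truncation. *)
    case=> [Qn|/calPP[t [t0 tn ->]]].
      by apply: lt_le_trans P0 _; exact: Pmin.2.
    by rewrite L_moment_functional; apply: mpos t0; rewrite tn smk.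
  split; first by apply/real_iff; rewrite P0.
  by exists P; split=> //; left; exact: Pmin.1.
- move=> n2 [mr [P0 [P0n LP0]]]; split.
    have calP_size j (P : {poly R}) : calP j P -> (j < n)%N -> (size P <= n)%N.
      by case=> _ ->.
    (* The truncation has length n - 1, so the annihilated polynomial has degree n - 1 or n - 2,
       giving i = 1 or i = 2. *)
    rewrite sz in P0n; case: P0n => P0n.
      exists 1%N, P0; rewrite subn1 -takeE //; first by split=> //; left.
      by apply: calP_size P0n _; lia.
    exists 2%N, P0; rewrite subn2 -takeE //; first by split=> //; right.
    by apply: calP_size P0n _; lia.
  move=> i P i12 /calPP[s [s0 sn ->]]; rewrite !L_moment_functional => Ls0.
  have sim : (size s + i)%N = size m by rewrite sn sm; lia.
  have real_iff : realizable m <->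
      moment_functional (moment m) ('X^i * root_poly R s) = 0.
    split=> [{}mr|LX0]; first exact: realizable_vanish_mulXn.
    apply: (realizable_of_vanish_mulXn _ _ s0 sim Ls0 LX0); first by lia.
    by rewrite sm.
  split=> //; split=> [[/real_iff //]|/real_iff {}mr]; split=> //.
  rewrite sm; case: i12 => i_eq; subst i.
    exists (root_poly R s); rewrite L_moment_functional; split=> //; right.
    by apply/calPP; exists s; rewrite sn subn1.
  (* For i = 2 the degree n - 2 is too low to witness B-realizability of [m]; adding a pair of roots
     raises it to n. *)
  have [a as0] := nonneg_roots_cons2 s0.
  have asn : size ([:: a.+1; a] ++ s) = n by rewrite /= sn; lia.
  exists (root_poly R ([:: a.+1; a] ++ s)); rewrite L_moment_functional; split.
    by left; apply/calPP; exists [:: a.+1, a & s].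
  by apply: realizable_vanish_cat; rewrite // asn sm.
Qed.
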